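(* Let $G$ be an Abelian group generated by the elements $g_1,g_2,\dots,g_t$. Then a function $f:G\to\mathbb{C}$ is a polynomial if and only if there are natural numbers $n_1,n_2,\dots,n_t$ such that $$\Delta_{g_i}^{n_i+1}*f=0$$ for $i=1,2,\dots,t$.
   Context: Natural numbers include $0$. For an Abelian group $G$ (written additively), $\mathbb{C}G$ is the algebra of finitely supported complex valued functions on $G$ with convolution $\mu*\nu(x)=\sum_{y\in G}\mu(x-y)\nu(y)$; $\delta_y$ is the characteristic function of $\{y\}$. The algebra acts on all functions $f:G\to\mathbb{C}$ by $\mu*f(x)=\sum_{y\in G} f(x-y)\mu(y)$. The difference with increment $y\in G$ is $\Delta_y=\delta_{-y}-\delta_0$, so that $\Delta_y*f(x)=f(x+y)-f(x)$, and $\Delta_y^{m}$ is the $m$-fold convolution power of $\Delta_y$. An additive function on $G$ is a homomorphism $a:G\to(\mathbb{C},+)$. A function $p:G\to\mathbb{C}$ is a polynomial if it belongs to the function algebra generated by the additive functions and the constants, i.e. $p(x)=P(a_1(x),\dots,a_n(x))$ for all $x\in G$, where $a_1,\dots,a_n:G\to\mathbb{C}$ are additive and $P:\mathbb{C}^n\to\mathbb{C}$ is an ordinary complex polynomial in $n$ variables. *)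

(* Defs.v *)
From HB Require Import structures.
From mathcomp Require Import all_boot all_order all_algebra.
From mathcomp Require Import finmap.
From mathcomp Require monalg mpoly.

Set Implicit Arguments.
Unset Strict Implicit.
Unset Printing Implicit Defensive.

Import GRing.Theory.

Local Open Scope fset_scope.
Local Open Scope ring_scope.

(* Only the additive structure of {malg C[G]} (finitely supported functions   *)
(* G -> C) comes from the library: its product needs a [monomType], which no  *)
(* nontrivial group is, because x * y = 1 must force x = y = 1 there.         *)
Section GroupAlgebra.

(* The notations of monalg and mpoly clash: they are imported in separate     *)
(* sections.                                                                  *)
Import monalg.

Variables (C : comNzRingType) (G : zmodType).
Implicit Types (mu nu : {malg C[G]}) (x y : G).

(* The index set only provides a finite domain; see [convE]. *)
Definition conv mu nu : {malg C[G]} :=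
  [malg x in [fset z + y | z in msupp mu, y in msupp nu] =>
     \sum_(y <- msupp nu) mu@_(x - y) * nu@_y].

Lemma convE mu nu x :
  (conv mu nu)@_x = \sum_(y <- msupp nu) mu@_(x - y) * nu@_y.
Proof.
rewrite mcoeffE; case: ifPn => // xNin; rewrite big_seq big1 // => y ynu.
rewrite [mu@_(x - y)]mcoeff_outdom ?mul0r //.
apply: contra xNin => xymu; apply/imfset2P.
by exists (x - y) => //; exists y => //; rewrite subrK.
Qed.

Definition convX mu m : {malg C[G]} := iter m (conv mu) << 0%R >>.

Definition act mu (f : G -> C) x : C := \sum_(y <- msupp mu) f (x - y) * mu@_y.

Definition Delta y : {malg C[G]} := << (- y)%R >> - << 0%R >>.

Lemma act_Delta y (f : G -> C) x : act (Delta y) f x = f (x + y) - f x.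
Proof.
have actU (d : {fset G}) mu : msupp mu `<=` d ->
    act mu f x = \sum_(z <- d) f (x - z) * mu@_z.
  move=> sd; rewrite /act (big_fset_incl _ sd) // => z _ zN.
  by rewrite mcoeff_outdom ?mulr0.
rewrite (actU (msupp (Delta y) `|` [fset - y; 0])) ?fsubsetUl //.
set d := _ `|` _.
have pick u : u \in d ->
    \sum_(z <- d) f (x - z) * (<< u >> : {malg C[G]})@_z = f (x - u).
  move=> ud; rewrite (big_fsetD1 u) //= mcoeffUU mulr1 big_seq big1 ?addr0 //.
  by move=> z; rewrite !inE mcoeffU eq_sym => /andP[/negbTE-> _]; rewrite mulr0.
under eq_bigr do rewrite /Delta mcoeffB mulrBr.
by rewrite sumrB !pick ?opprK ?subr0 // !inE eqxx ?orbT.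
Qed.

End GroupAlgebra.

Arguments Delta {C G} y.

Section Polynomial.

Import mpoly.

Definition is_polynomial (C : comNzRingType) (G : zmodType) (p : G -> C) : Prop :=
  exists (n : nat) (a : 'I_n -> {additive G -> C}) (P : {mpoly C[n]}),
    forall x, p x = P.@[fun i => a i x].

End Polynomial.

(* Every subgroup containing all the g i is the whole of G. *)
Definition generated_by (G : zmodType) (t : nat) (g : 'I_t -> G) : Prop :=
  forall H : G -> Prop,
    H 0 -> (forall x y, H x -> H y -> H (x - y)) ->
    (forall i, H (g i)) -> forall x, H x.

(* Main.v *)
Require Import Defs.
From HB Require Import structures.
From mathcomp Require Import all_boot all_order all_algebra complex reals.
From mathcomp Require Import finmap boolp ring zify.
From mathcomp Require monalg mpoly.

(** The operator [act (convX (Delta y) m)] is the [m]-th iterate of the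
    difference [diff y], because [act] is an action of the group algebra
    ([act_conv]); so the theorem is about iterated differences.

    A polynomial is killed by high iterates of every difference: constants are
    killed by one, additive functions by two, and by the Leibniz rule
    ([iter_diffM]) the functions killed by some fixed iterate of all
    differences are closed under products.

    Conversely, let high iterates of [diff (g i)] kill [f]. Pull [f] back to
    the lattice Z^t along [comb g : k |-> \sum_i g i *~ k_i]. Newton
    interpolation in one coordinate after the other ([lattice_poly_comb])
    gives a polynomial [Q] in [t] variables with [f (comb g k) = Q k] on Z^t.
    When the [g i] are independent, the coordinates [k_i] are additive on [G]
    and this is the claim. In general they are only defined up to the relations
    [l], the elements of Z^t with [comb g l = 0]. Each relation is a period of
    [Q] on Z^t, hence on C^t, since a polynomial that vanishes on Z^t is zero.
    For the same reason the periods of [Q] are closed under scaling by complex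
    numbers, so every vector of the complex span [U] of the relations is a
    period ([period_submx]). Let [pi] be a linear projection of C^t with kernel
    [U]. Then [Q k = Q (k pi)], while the coordinates of [k pi] vanish on
    relations and so define additive functions on [G]: [f] is [Q] of these
    ([lattice_poly_descent]). *)

Set Implicit Arguments.
Unset Strict Implicit.
Unset Printing Implicit Defensive.

Import GRing.Theory Num.Theory.

Local Open Scope fset_scope.
Local Open Scope ring_scope.

(** * The action of powers of a difference *)

Section Action.

Import monalg.

Variables (C : comNzRingType) (G : zmodType).
Implicit Types (mu nu : {malg C[G]}) (f : G -> C) (x y : G).

Lemma act_widen (d : {fset G}) mu f x : msupp mu `<=` d ->
  act mu f x = \sum_(z <- d) f (x - z) * mu@_z.
Proof.
move=> sd; rewrite /act (big_fset_incl _ sd) // => z _ zN.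
by rewrite mcoeff_outdom ?mulr0.
Qed.

(** Substituting [w = z + y] in the convolution sum turns it into the iterated
    sum. *)
Lemma act_conv mu nu f x : act (conv mu nu) f x = act mu (act nu f) x.
Proof.
pose D := msupp (conv mu nu) `|` [fset z + y | z in msupp mu, y in msupp nu].
rewrite (act_widen (d := D)) ?fsubsetUl //.
under eq_bigr do rewrite convE mulr_sumr.
rewrite exchange_big /=.
transitivity (\sum_(z <- msupp nu) \sum_(y <- msupp mu)
                 f (x - y - z) * mu@_y * nu@_z); last first.
  rewrite exchange_big; apply: eq_bigr => y _; rewrite mulr_suml.
  by apply: eq_bigr => z _; rewrite mulrAC.
rewrite big_seq [RHS]big_seq; apply: eq_bigr => z zin.
(* Translating D by - z gives a finite set that still contains the support    *)
(* of mu.                                                                     *)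
pose D' := [fset w - z | w in D].
have sD' : msupp mu `<=` D'.
  apply/fsubsetP => y ymu; apply/imfsetP; exists (y + z); last by rewrite addrK.
  by rewrite /= inE; apply/orP; right; apply/imfset2P; exists y => //; exists z.
rewrite (big_fset_incl _ sD') => [|w _ wN]; last first.
  by rewrite mcoeff_outdom // mulr0 mul0r.
rewrite [RHS]big_imfset /=; last by move=> u v _ _ /(addIr (- z)).
by apply: eq_bigr => w _; rewrite mulrA opprB addrA addrAC addrK.
Qed.

Definition diff y f x : C := f (x + y) - f x.

Lemma act_convX_Delta y m f : act (convX (Delta y) m) f = iter m (diff y) f.
Proof.
apply: funext => x; elim: m x => [|m IHm] x.
  rewrite /convX /= (act_widen (d := [fset 0%R])) ?msuppU_le //.
  by rewrite big_seq_fset1 mcoeffUU mulr1 subr0.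
by rewrite /convX iterS act_conv act_Delta !IHm.
Qed.

(** * Functions killed by a power of a difference *)

Lemma iter_diff0 y m : iter m (diff y) (fun=> 0) = (fun=> 0).
Proof.
by elim: m => //= m ->; apply: funext => x; rewrite /diff subrr.
Qed.

Lemma iter_diffC y z m n f :
  iter m (diff y) (iter n (diff z) f) = iter n (diff z) (iter m (diff y) f).
Proof.
have diffC h : diff y (diff z h) = diff z (diff y h).
  by apply: funext => x; rewrite /diff (addrAC x z y); ring.
have diff_iterC k h : diff y (iter k (diff z) h) = iter k (diff z) (diff y h).
  by elim: k => //= k IHk; rewrite diffC IHk.
by elim: m => //= m ->; rewrite diff_iterC.
Qed.

Lemma iter_diffD y m f h :
  iter m (diff y) (fun x => f x + h x) =
  fun x => iter m (diff y) f x + iter m (diff y) h x.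
Proof.
elim: m => //= m ->; apply: funext => x; rewrite /diff; ring.
Qed.

Lemma iter_diff_translate y z m f :
  iter m (diff y) (fun x => f (x + z)) = fun x => iter m (diff y) f (x + z).
Proof.
by elim: m => //= m ->; apply: funext => x; rewrite /diff addrAC.
Qed.

Lemma iter_diff_le y m n f : (m <= n)%N ->
  iter m (diff y) f = (fun=> 0) -> iter n (diff y) f = (fun=> 0).
Proof. by move=> lemn f0; rewrite -(subnK lemn) iterD f0 iter_diff0. Qed.

(** Since [diff y (f h) = diff y f * h + f (- + y) * diff y h], one difference
    lowers the order of one of the two factors and leaves that of the other
    unchanged; induction on the sum of the orders. *)
Lemma iter_diffM y m n f h :
    iter m (diff y) f = (fun=> 0) -> iter n (diff y) h = (fun=> 0) ->
  iter (m + n) (diff y) (fun x => f x * h x) = (fun=> 0).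
Proof.
move eqN: (m + n)%N => N; elim: N => [|N IHN] in m n f h eqN *.
  case: m n eqN => [|m] [|n] //= _ -> _.
  by apply: funext => x; rewrite mul0r.
case: m eqN => [_ f0 _|m eqN f0].
  rewrite (_ : (fun x => f x * h x) = fun=> 0) ?iter_diff0 //.
  by apply: funext => x; rewrite [f]f0 mul0r.
case: n eqN => [_ h0|n eqN h0].
  rewrite (_ : (fun x => f x * h x) = fun=> 0) ?iter_diff0 //.
  by apply: funext => x; rewrite [h]h0 mulr0.
rewrite iterSr (_ : diff y _ =
  (fun x => diff y f x * h x + f (x + y) * diff y h x)); last first.
  by apply: funext => x; rewrite /diff; ring.
rewrite iter_diffD; apply: funext => x.
rewrite (IHN m n.+1) ?(IHN m.+1 n) ?addr0 // -?iterSr //; first lia.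
- by rewrite iter_diff_translate f0.
- lia.
Qed.

(** The exponent is uniform in the increment, as the degree of a polynomial
    does not depend on the direction; no exponent then has to be chosen for
    each generator. *)
Definition bounded_order f := exists m, forall y, iter m (diff y) f = (fun=> 0).

Lemma bounded_order_cst c : bounded_order (fun=> c).
Proof. by exists 1%N => y; apply: funext => x; rewrite /= /diff subrr. Qed.

Lemma bounded_order_additive (a : {additive G -> C}) : bounded_order a.
Proof.
exists 2%N => y; apply: funext => x; rewrite /= /diff !raddfD /=; ring.
Qed.

Lemma bounded_orderD f h :
  bounded_order f -> bounded_order h -> bounded_order (fun x => f x + h x).
Proof.
move=> [m f0] [n h0]; exists (m + n)%N => y; rewrite iter_diffD.
rewrite (iter_diff_le (leq_addr n m) (f0 y)).
rewrite (iter_diff_le (leq_addl m n) (h0 y)).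
by apply: funext => x; rewrite addr0.
Qed.

Lemma bounded_orderM f h :
  bounded_order f -> bounded_order h -> bounded_order (fun x => f x * h x).
Proof. by move=> [m f0] [n h0]; exists (m + n)%N => y; apply: iter_diffM. Qed.

End Action.

Section BoundedOrderPolynomial.

Import mpoly.

Variables (C : comNzRingType) (G : zmodType).

Lemma polynomial_bounded_order (f : G -> C) :
  is_polynomial f -> bounded_order f.
Proof.
move=> [n [a [P fE]]].
rewrite (_ : f = fun x => P.@[fun i => a i x]); last exact: funext.
under eq_fun do rewrite mevalE.
elim: (msupp P) => [|m s IHs].
  by under eq_fun do rewrite big_nil; apply: bounded_order_cst.
under eq_fun do rewrite big_cons.
apply: bounded_orderD IHs; apply: bounded_orderM.
  exact: bounded_order_cst.
elim: (index_enum _) => [|i r IHr].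
  by under eq_fun do rewrite big_nil; apply: bounded_order_cst.
under eq_fun do rewrite big_cons; apply: bounded_orderM IHr.
elim: (m i) => [|k IHk].
  by under eq_fun do rewrite expr0; apply: bounded_order_cst.
under eq_fun do rewrite exprS.
by apply: bounded_orderM IHk; apply: bounded_order_additive.
Qed.

End BoundedOrderPolynomial.

(** * Newton interpolation along the generators *)

Section Newton.

Variables (C : numFieldType) (G : zmodType).
Implicit Types (f : G -> C) (x y : G).

(** The binomial coefficient [X choose j]. *)
Definition bin_poly j : {poly C} :=
  (j`!%:R)^-1 *: \prod_(i < j) ('X - i%:R%:P).

Lemma bin_poly0E c : (bin_poly 0).[c] = 1.
Proof. by rewrite /bin_poly big_ord0 invr1 scale1r hornerC. Qed.

Lemma bin_polyS0 j : (bin_poly j.+1).[0] = 0.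
Proof.
by rewrite /bin_poly hornerZ big_ord_recl hornerM hornerXsubC subrr mul0r mulr0.
Qed.

Lemma bin_polyS j c :
  (bin_poly j.+1).[c + 1] = (bin_poly j.+1).[c] + (bin_poly j).[c].
Proof.
rewrite /bin_poly !hornerZ [in LHS]big_ord_recl [in RHS]big_ord_recr.
rewrite !hornerM !horner_prod /=.
rewrite (eq_bigr (fun i : 'I_j => ('X - i%:R%:P).[c])); last first.
  by move=> i _; rewrite /bump /= !hornerXsubC natrD; ring.
rewrite !hornerXsubC factS natrM; field.
by rewrite nat1r !pnatr_eq0 /= -lt0n fact_gt0.
Qed.

(** The two sides agree at [0], and have the same difference in [k], by the case
    of [diff y f] and Pascal's rule [bin_polyS]; hence they agree on all of Z,
    upwards and downwards. *)
Lemma newton_interpolation y m f : iter m (diff y) f = (fun=> 0) ->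
  forall x (k : int),
    f (x + y *~ k) = \sum_(j < m) (bin_poly j).[k%:~R] * iter j (diff y) f x.
Proof.
elim: m f => [|m IHm] f f0 x k; first by rewrite big_ord0 [f]f0.
have step (l : int) : f (x + y *~ (l + 1)) = f (x + y *~ l) +
    \sum_(j < m) (bin_poly j).[l%:~R] * iter j.+1 (diff y) f x.
  under eq_bigr do rewrite iterSr.
  by rewrite -IHm -?iterSr // /diff mulrzDr addrA subrKC.
pose F (l : int) :=
  \sum_(j < m.+1) (bin_poly j).[l%:~R] * iter j (diff y) f x.
have stepF l : F (l + 1) = F l +
    \sum_(j < m) (bin_poly j).[l%:~R] * iter j.+1 (diff y) f x.
  rewrite /F !big_ord_recl !bin_poly0E -addrA -big_split; congr (_ + _) => /=.
  apply: eq_bigr => j _; rewrite intrD bin_polyS mulrDl.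
  by rewrite addrC.
rewrite -/(F k); elim/int_ind: k => [|n IHn|n IHn].
- rewrite /F big_ord_recl bin_poly0E mul1r big1 ?addr0 // => j _.
  by rewrite bin_polyS0 mul0r.
- by rewrite -addn1 PoszD step IHn stepF.
- have eqn : - (n.+1)%:Z + 1 = - n%:Z by lia.
  by move: IHn; rewrite -eqn step stepF => /addIr.
Qed.

End Newton.

Section Coordinates.

Import mpoly.

Variables (C : numFieldType) (G : zmodType) (t : nat) (g : 'I_t -> G).

Definition lattice_poly (h : 'rV[int]_t -> C) :=
  exists Q : {mpoly C[t]}, forall k, h k = Q.@[map_mx intr k 0].

Definition comb (k : 'rV[int]_t) := \sum_i g i *~ k 0 i.

(** Newton interpolation in the direction [g i] replaces the dependence on the
    coordinate [k_i] by polynomials in [k_i], with the functions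
    [iter j (diff (g i)) f] as coefficients. As differences commute, these
    satisfy the same hypotheses as [f], so the remaining coordinates can be
    treated in the same way. *)
Lemma lattice_poly_comb (n : 'I_t -> nat) (f : G -> C) :
    (forall i, iter (n i) (diff (g i)) f = (fun=> 0)) ->
  lattice_poly (fun k => f (comb k)).
Proof.
rewrite /comb; elim: (index_enum _) f => [|i s IHs] f f0.
  by exists (f 0)%:MP => k; rewrite big_nil mevalC.
under eq_fun do rewrite big_cons addrC (newton_interpolation (f0 i)).
elim: (index_enum _) => [|j r [Q QE]].
  by exists 0 => k; rewrite big_nil meval0.
have [|Qj QjE] := IHs (iter j (diff (g i)) f).
  by move=> l; rewrite iter_diffC f0 iter_diff0.
exists ((map_poly (@mpolyC t C) (bin_poly C j)).['X_i] * Qj + Q) => k.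
rewrite big_cons mevalD mevalM -QE -QjE; congr (_ * _ + _).
rewrite -[RHS]horner_map /= mevalXU mxE -map_poly_comp map_poly_id // => c _.
by rewrite /= mevalC.
Qed.

End Coordinates.

(** * Periods of a polynomial form a complex subspace *)

Section Periods.

Import mpoly.

Variables (C : numFieldType) (t : nat).
Implicit Types (h : 'rV[C]_t -> C) (u v w : 'rV[C]_t) (p : {poly C}).

Lemma poly_vanish_nat p : (forall n : nat, p.[n%:R] = 0) -> p = 0.
Proof.
move=> p0; apply/eqP; apply: contraT => pn0.
have := max_poly_roots pn0 (rs := [seq n%:R | n <- iota 0 (size p)]).
rewrite size_map size_iota ltnn map_inj_uniq ?iota_uniq => [-> //|m n /eqP].
  by apply/allP => _ /mapP[n _ ->]; apply/rootP.
by rewrite eqr_nat => /eqP.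
Qed.

(** All that the periodicity arguments use of a polynomial function. Unlike a
    representation by a formal polynomial, it passes at once to translates and
    differences. *)
Definition poly_on_lines h :=
  forall u v, exists p, forall c, h (u + c *: v) = p.[c].

Lemma meval_poly_on_lines (P : {mpoly C[t]}) :
  poly_on_lines (fun u => P.@[u 0]).
Proof.
move=> u v; exists (\sum_(m <- msupp P)
  P@_m *: \prod_i ((u 0 i)%:P + v 0 i *: 'X) ^+ m i) => c.
rewrite mevalE horner_sum; apply: eq_bigr => m _.
rewrite hornerZ horner_prod; congr (_ * _); apply: eq_bigr => i _.
by rewrite horner_exp !hornerE !mxE mulrC.
Qed.

(** One coordinate after the other is freed from being an integer: along the
    line in that direction, the restriction of [h] is a polynomial with all
    natural numbers as roots. *)
Lemma vanish_lattice h : poly_on_lines h ->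
  (forall k : 'rV[int]_t, h (map_mx intr k) = 0) -> forall u, h u = 0.
Proof.
move=> hline h0.
pose mix (s : seq 'I_t) u (k : 'rV[int]_t) : 'rV[C]_t :=
  \row_i (if i \in s then u 0 i else (k 0 i)%:~R).
suff mix0 s u k : h (mix s u k) = 0.
  move=> u; rewrite -(mix0 (enum 'I_t) u 0); congr h; apply/rowP => i.
  by rewrite mxE mem_enum.
elim: s u k => [|j s IHs] u k.
  by rewrite -(h0 k); congr h; apply/rowP => i; rewrite !mxE.
pose line (c : C) := (\row_i (if i == j then 0 else mix s u k 0 i)) +
  c *: (delta_mx 0 j : 'rV[C]_t).
have [p pE] := hline (line 0) (delta_mx 0 j).
have lineE c : h (line c) = p.[c] by rewrite -pE /line scale0r addr0.
have -> : mix (j :: s) u k = line (u 0 j).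
  apply/rowP => i; rewrite !mxE inE eqxx /=.
  by case: eqP => [->|_]; rewrite ?add0r ?mulr1 // mulr0 addr0.
rewrite lineE (_ : p = 0) ?horner0 //; apply: poly_vanish_nat => n.
rewrite -lineE.
(* Both [u] and [k] are changed at [j], as [j] may occur in [s] again. *)
rewrite -(IHs (\row_i (if i == j then n%:R else u 0 i))
              (\row_i (if i == j then n%:Z else k 0 i))).
congr h; apply/rowP => i; rewrite !mxE eqxx /=.
by case: eqP => [->|_]; rewrite ?add0r ?mulr1 ?if_same // mulr0 addr0.
Qed.

Definition period h w := forall u, h (u + w) = h u.

Lemma period_lattice h w : poly_on_lines h ->
    (forall k : 'rV[int]_t, h (map_mx intr k + w) = h (map_mx intr k)) ->
  period h w.
Proof.
move=> hline hw u; apply/eqP; rewrite -subr_eq0; apply/eqP.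
apply: (vanish_lattice (h := fun u => h (u + w) - h u)) => [{}u v|k].
  have [p pE] := hline (u + w) v; have [q qE] := hline u v.
  by exists (p - q) => c; rewrite hornerD hornerN -pE -qE addrAC.
by rewrite hw subrr.
Qed.

(** The polynomial [c |-> h (u + c w) - h u] has all natural numbers as
    roots. *)
Lemma periodZ h c w : poly_on_lines h -> period h w -> period h (c *: w).
Proof.
move=> hline hw u; have [p pE] := hline u w.
have p0 : p - (h u)%:P = 0.
  apply: poly_vanish_nat => n; rewrite hornerD hornerN hornerC -pE.
  elim: n => [|n IHn]; first by rewrite scale0r addr0 subrr.
  by rewrite -natr1 scalerDl scale1r addrA hw.
by rewrite pE (subr0_eq p0) hornerC.
Qed.

Lemma period_submx h m (U : 'M[C]_(m, t)) w : poly_on_lines h ->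
  (forall i, period h (row i U)) -> (w <= U)%MS -> period h w.
Proof.
move=> hline hU /submxP[D ->]; rewrite mulmx_sum_row.
elim/big_ind: _ => [u|v w' hv hw u|i _]; first by rewrite addr0.
  by rewrite addrA hw hv.
exact: periodZ.
Qed.

End Periods.

(** A matrix of maximal rank among those with rows in [S]: adding a further
    vector of [S] as a row does not increase the rank. *)
Lemma exists_spanning_mx (F : fieldType) t (S : 'rV[F]_t -> Prop) :
  exists m (U : 'M[F]_(m, t)),
    (forall i, S (row i U)) /\ forall v, S v -> (v <= U)%MS.
Proof.
pose rank_in r := `[< exists m (U : 'M[F]_(m, t)),
  (forall i, S (row i U)) /\ \rank U = r >].
have ex_rank : exists r, rank_in r.
  by exists 0%N; apply/asboolP; exists 0%N, 0; split=> [[]|]; rewrite ?mxrank0.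
have ub_rank r : rank_in r -> (r <= t)%N.
  by move=> /asboolP[m [U [_ <-]]]; apply: rank_leq_col.
case: (ex_maxnP ex_rank ub_rank) => r /asboolP[m [U [SU rU]]] rmax.
exists m, U; split=> // v Sv.
have sUvU : (U <= col_mx v U)%MS by rewrite -addsmxE addsmxSr.
apply: (submx_trans (B := col_mx v U)); first by rewrite -addsmxE addsmxSl.
rewrite -(mxrank_leqif_sup sUvU) eqn_leq mxrankS //= rU.
apply: rmax; apply/asboolP; exists (1 + m)%N, (col_mx v U); split=> // i.
case: (split_ordP i) => j ->; first by rewrite rowKu row_id ?ord1.
by rewrite rowKd.
Qed.

(** * Descent from the lattice to the group *)

Section Descent.

Import mpoly.

Variables (C : numFieldType) (G : zmodType) (t : nat) (g : 'I_t -> G).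

Lemma combB k l : comb g (k - l) = comb g k - comb g l.
Proof.
by rewrite /comb -sumrB; apply: eq_bigr => i _; rewrite !mxE mulrzBr.
Qed.

Lemma comb_surj : generated_by g -> forall x, exists k, comb g k == x.
Proof.
apply=> [|x y [k /eqP <-] [l /eqP <-]|i].
- by exists 0; rewrite /comb big1 // => i _; rewrite mxE mulr0z.
- by exists (k - l); rewrite combB.
exists (delta_mx 0 i); rewrite /comb (bigD1 i) //= big1 => [|j /negbTE ji].
  by rewrite mxE !eqxx mulr1z addr0.
by rewrite mxE ji andbF mulr0z.
Qed.

(** The projection along the span [U] of the relations makes the lattice
    coordinates of an element of [G] independent of their choice. *)
Lemma lattice_poly_descent (f : G -> C) : generated_by g ->
  lattice_poly (fun k => f (comb g k)) -> is_polynomial f.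
Proof.
move=> hg [Q QE].
pose coord x := xchoose (comb_surj hg x).
have coordK x : comb g (coord x) = x by apply/eqP/(xchooseP (comb_surj hg x)).
have [m [U [relU spanU]]] := exists_spanning_mx
  (fun w : 'rV[C]_t => exists2 k, comb g k = 0 & w = map_mx intr k).
have hline := meval_poly_on_lines Q.
have periodU w : (w <= U)%MS -> period (fun u => Q.@[u 0]) w.
  apply: period_submx => // i; have [l l0 ->] := relU i.
  apply: period_lattice => // k.
  by rewrite -map_mxD -!QE -[k in RHS](addrK l) combB l0 subr0.
(* Right multiplication by [K] has the row space of [U] as kernel; [pi] has   *)
(* the same kernel and is idempotent.                                         *)
pose K := cokermx U; pose pi := K *m pinvmx K.
pose b j x := (map_mx intr (coord x) *m pi) 0 j.
have bB j : zmod_morphism (b j).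
  move=> x y; apply/eqP; rewrite -subr_eq0 /b; apply/eqP.
  (* The defect of additivity of [coord] is a relation. *)
  pose l := coord (x - y) - (coord x - coord y).
  transitivity ((map_mx intr l *m pi) 0 j).
    by rewrite !map_mxB !mulmxBl !mxE.
  have : (map_mx intr l <= U)%MS.
    by apply: spanU; exists l; rewrite // !combB !coordK subrr.
  by rewrite submxE -/K => /eqP lK; rewrite /pi mulmxA lK mul0mx mxE.
pose a j : {additive G -> C} :=
  HB.pack (b j) (GRing.isZmodMorphism.Build _ _ (b j) (bB j)).
exists t, a, Q => x.
pose u : 'rV[C]_t := map_mx intr (coord x).
rewrite -{1}(coordK x) QE -/u.
rewrite -(periodU (u *m pi - u)) ?subrKC.
  by apply: meval_eq.
by rewrite submxE -/K mulmxBl -mulmxA /pi mulmxKpV // subrr.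
Qed.

End Descent.

Theorem theorem4 (R : realType) (G : zmodType) (t : nat) (g : 'I_t -> G)
    (hg : generated_by g) (f : G -> R[i]) :
  is_polynomial f <->
  exists n : 'I_t -> nat,
    forall i : 'I_t, act (convX (Delta (g i)) (n i).+1) f =1 (fun=> 0).
Proof.
split=> [/polynomial_bounded_order[m f0]|[n f0]].
  exists (fun=> m) => i x.
  by rewrite act_convX_Delta (iter_diff_le (leqnSn m)).
apply: (lattice_poly_descent hg).
apply: (lattice_poly_comb (n := fun i => (n i).+1)) => i.
by rewrite -act_convX_Delta; apply: funext; apply: f0.
Qed.
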